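(* Let $m\ge 1$, let $0<b_0<b_1<\cdots<b_m$ be integers and let $e_0,e_1,\dots,e_m$ be positive integers. Assume there exist a prime $p$ and a positive integer $t$ such that $p^t\mid b_0$ but $p^t\nmid b_i$ for all $1\le i\le m$. Put $\mathrm M=\{(b_0,e_0),\dots,(b_m,e_m)\}$. Then for every infinite set $\mathcal A$ of positive integers, the representation function $r_{\mathrm M}(n,\mathcal A)$ is not constant for $n$ large enough; that is, there are no constant $c$ and no integer $n_0$ such that $r_{\mathrm M}(n,\mathcal A)=c$ for all $n>n_0$.
   Context: For $\mathrm M=\{(b_0,e_0),\dots,(b_m,e_m)\}$ and a set $\mathcal A$ of integers $\ge 0$, $r_{\mathrm M}(n,\mathcal A)$ denotes the number of tuples $(a_{i,j})_{0\le i\le m,\ 1\le j\le e_i}$ with all $a_{i,j}\in\mathcal A$ and $$n=b_0(a_{0,1}+\cdots+a_{0,e_0})+b_1(a_{1,1}+\cdots+a_{1,e_1})+\cdots+b_m(a_{m,1}+\cdots+a_{m,e_m}).$$ *)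

(* Defs.v *)
From mathcomp Require Import all_boot.
From mathcomp Require Import finmap.
From mathcomp Require Import mathcomp_extra boolp classical_sets functions cardinality.

Set Implicit Arguments.
Unset Strict Implicit.
Unset Printing Implicit Defensive.

Local Open Scope classical_set_scope.

(* The set M = {(b_0,e_0),...,(b_m,e_m)} is given by b, e : 'I_m.+1 -> nat;
   the pairs (i, j) with 0 <= i <= m and 1 <= j <= e_i are the elements of
   {i : 'I_m.+1 & 'I_(e i)}, with j shifted to 0 <= j < e_i. *)
Definition representations (m : nat) (b e : 'I_m.+1 -> nat) (A : set nat)
    (n : nat) : set {ffun {i : 'I_m.+1 & 'I_(e i)} -> nat} :=
  [set a : {ffun {i : 'I_m.+1 & 'I_(e i)} -> nat} | (forall ij, A (a ij)) /\
    n = \sum_(i < m.+1)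
          b i * \sum_(j < e i) a (Tagged (fun i => 'I_(e i)) j)].
Arguments representations {m} b e A n.

(* fset_set X is empty when X is infinite; by finite_representations this does
   not happen when all the b i are positive. *)
Definition rep_fun (m : nat) (b e : 'I_m.+1 -> nat) (A : set nat) (n : nat)
    : nat :=
  #|` fset_set (representations b e A n)|%fset.

Lemma finite_representations (m : nat) (b e : 'I_m.+1 -> nat) (A : set nat)
    (n : nat) :
  (forall i, 0 < b i) -> finite_set (representations b e A n).
Proof.
move=> b_gt0.
pose IJ := {i : 'I_m.+1 & 'I_(e i)}.
pose f (g : {ffun IJ -> 'I_n.+1}) : {ffun IJ -> nat} := [ffun x => val (g x)].
apply: (@sub_finite_set _ _ (f @` setT)); last first.
  exact/finite_image/finite_finset.
move=> a [_ nE].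
have a_le ij : a ij < n.+1.
  case: ij => i j; rewrite ltnS nE (bigD1 i)//= (bigD1 j)//=.
  apply: leq_trans (leq_addr _ _); apply: leq_trans (leq_pmull _ (b_gt0 i)).
  exact: leq_addr.
exists [ffun ij => Ordinal (a_le ij)] => //.
by apply/ffunP => ij; rewrite !ffunE.
Qed.

(* Main.v *)
(* Let f = sum_(a in A) X^a. If r is eventually equal to c, then
     (X - 1) * prod_i f(X^(b_i))^(e_i) = Q
   is an integer polynomial with Q(1) = -c != 0. Up to factors X^d - 1, as many in
   the numerator as in the denominator, Q is a polynomial Q2 none of whose roots
   is a root of unity. If l is the logarithmic derivative X f' / f, taking
   logarithmic derivatives gives
     sum_(b_i | n) e_i b_i l_(n / b_i) = sum_(d | n) d q_d - sum_a a^(-n)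
   with a running over the roots of Q2 and q integral, finitely supported and of
   total mass 1. Along n (1 + N j) all terms are exponential sums in j, and
   isolating the coefficient of the ratio 1 removes the roots of Q2. By Moebius
   inversion there is y with
     sum_(b_i | n) e_i y_(n / b_i) = q_n.
   Since b_0 is the smallest b_i and the only one of maximal p-adic valuation, y is
   finitely supported. Grouping by p-adic valuation v, the polynomial
   E = sum_i e_i X^(v(b_i)) divides over C an integer polynomial with value 1 at 1.
   By Gauss's lemma so does the primitive part of E over Z; but its coefficients are
   nonnegative and at least two are positive, so its value at 1 is at least 2. *)
From HB Require Import structures.
Require Import Defs.
From mathcomp Require Import all_boot all_order all_algebra all_field.
From mathcomp Require Import finmap.
From mathcomp Require Import boolp classical_sets functions cardinality.
From mathcomp Require Import ring zify.

Set Implicit Arguments.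
Unset Strict Implicit.
Unset Printing Implicit Defensive.

Import Order.TTheory GRing.Theory Num.Theory.
Local Open Scope ring_scope.

(** * Formal power series *)

(** A name of its own for [nat -> R], to which the ring structure with the Cauchy product is
    attached. *)
Definition fps (R : fieldType) : Type := nat -> R.

Definition fps_mul (R : fieldType) (f g : fps R) : fps R :=
  fun n => \sum_(i < n.+1) f i * g (n - i)%N.

Definition fps_trunc (R : fieldType) (n : nat) (f : fps R) : {poly R} :=
  \poly_(i < n.+1) f i.

(** A coefficient of a product involves only coefficients up to the same index, so the ring laws are
    inherited from [{poly R}]. *)
Lemma fps_mul_trunc (R : fieldType) (f g : fps R) (n k : nat) :
  (k <= n)%N -> fps_mul f g k = (fps_trunc n f * fps_trunc n g)`_k.
Proof.
move=> k_le; rewrite coefM; apply: eq_bigr => -[i /= i_lt] _.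
by rewrite !coef_poly !ifT //; lia.
Qed.

Lemma fps_mulA (R : fieldType) : associative (@fps_mul R).
Proof.
move=> f g h; apply/funext => n.
have tr (u v : fps R) i : (i <= n)%N ->
    (fps_trunc n (fps_mul u v))`_i = (fps_trunc n u * fps_trunc n v)`_i.
  by move=> i_le; rewrite coef_poly ifT // (@fps_mul_trunc _ _ _ n).
rewrite (@fps_mul_trunc _ _ _ n) // (@fps_mul_trunc _ _ h n) //.
transitivity ((fps_trunc n f * (fps_trunc n g * fps_trunc n h))`_n).
  by rewrite !coefM; apply: eq_bigr => i _; rewrite tr ?leq_subr.
by rewrite mulrA !coefM; apply: eq_bigr => i _; rewrite tr // -ltnS.
Qed.

Lemma fps_mulC (R : fieldType) : commutative (@fps_mul R).
Proof.
by move=> f g; apply/funext => n; rewrite !(@fps_mul_trunc _ _ _ n) // mulrC.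
Qed.

Definition fps_one (R : fieldType) : fps R := fun n => (n == 0%N)%:R.

Lemma fps_mul1 (R : fieldType) : left_id (@fps_one R) (@fps_mul R).
Proof.
move=> f; apply/funext => n; rewrite /fps_mul /fps_one big_ord_recl /= mul1r.
by rewrite subn0 big1 ?addr0 // => i _; rewrite mul0r.
Qed.

HB.instance Definition _ (R : fieldType) := gen_eqMixin (fps R).
HB.instance Definition _ (R : fieldType) := gen_choiceMixin (fps R).

Lemma fps_addA (R : fieldType) :
  associative (fun (f g : fps R) => (fun n => f n + g n) : fps R).
Proof. by move=> f g h; apply/funext => n; rewrite addrA. Qed.

Lemma fps_addC (R : fieldType) :
  commutative (fun (f g : fps R) => (fun n => f n + g n) : fps R).
Proof. by move=> f g; apply/funext => n; rewrite addrC. Qed.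

Lemma fps_add0 (R : fieldType) :
  left_id ((fun => 0) : fps R) (fun (f g : fps R) => (fun n => f n + g n) : fps R).
Proof. by move=> f; apply/funext => n; rewrite add0r. Qed.

Lemma fps_addN (R : fieldType) :
  left_inverse ((fun => 0) : fps R) (fun f n => - f n)
    (fun (f g : fps R) => (fun n => f n + g n) : fps R).
Proof. by move=> f; apply/funext => n; rewrite addNr. Qed.

HB.instance Definition _ (R : fieldType) := GRing.isZmodule.Build (fps R)
  (@fps_addA R) (@fps_addC R) (@fps_add0 R) (@fps_addN R).

Lemma fpsD (R : fieldType) (f g : fps R) (n : nat) : (f + g) n = f n + g n.
Proof. by []. Qed.

Lemma fpsB (R : fieldType) (f g : fps R) (n : nat) : (f - g) n = f n - g n.
Proof. by []. Qed.

Lemma fps_mulDl (R : fieldType) : left_distributive (@fps_mul R) +%R.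
Proof.
move=> f g h; apply/funext => n; rewrite fpsD /fps_mul -big_split.
by apply: eq_bigr => i _; rewrite fpsD mulrDl.
Qed.

Lemma fps_one_neq0 (R : fieldType) : fps_one R != 0.
Proof.
apply/eqP => /(congr1 (fun f : fps R => f 0%N)) /eqP.
by rewrite [X in X == _]/(1%:R) [X in _ == X]/(0) oner_eq0.
Qed.

HB.instance Definition _ (R : fieldType) := GRing.Zmodule_isComNzRing.Build (fps R)
  (@fps_mulA R) (@fps_mulC R) (@fps_mul1 R) (@fps_mulDl R) (@fps_one_neq0 R).

Lemma fpsM (R : fieldType) (f g : fps R) (n : nat) :
  (f * g) n = \sum_(i < n.+1) f i * g (n - i)%N.
Proof. by []. Qed.

Lemma fps_sum (R : fieldType) (I : Type) (r : seq I) (P : pred I)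
    (F : I -> fps R) (n : nat) :
  (\sum_(i <- r | P i) F i) n = \sum_(i <- r | P i) F i n.
Proof. by elim/big_rec2: _ => // i y f _ <-. Qed.

(** * Polynomials as power series *)

Definition fps_of_poly (R : fieldType) (p : {poly R}) : fps R := fun n => p`_n.

Lemma fps_of_poly_is_zmod_morphism (R : fieldType) :
  zmod_morphism (@fps_of_poly R).
Proof. by move=> p q; apply/funext => n; rewrite fpsB /fps_of_poly coefB. Qed.

Lemma fps_of_poly_is_monoid_morphism (R : fieldType) :
  monoid_morphism (@fps_of_poly R).
Proof.
split=> [|p q]; apply/funext => n; first by rewrite /fps_of_poly coef1.
by rewrite /fps_of_poly coefM fpsM.
Qed.

HB.instance Definition _ (R : fieldType) :=
  GRing.isZmodMorphism.Build {poly R} (fps R) (@fps_of_poly R)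
    (@fps_of_poly_is_zmod_morphism R).
HB.instance Definition _ (R : fieldType) :=
  GRing.isMonoidMorphism.Build {poly R} (fps R) (@fps_of_poly R)
    (@fps_of_poly_is_monoid_morphism R).

Lemma fps_of_poly_inj (R : fieldType) : injective (@fps_of_poly R).
Proof. by move=> p q pq; apply/polyP => n; have := congr1 (@^~ n) pq. Qed.

(** Moves a coefficient of a product of series to polynomials, where a product of finite sums can be
    expanded. *)
Lemma fps_prod_coef (R : fieldType) (I : Type) (r : seq I) (F : I -> fps R)
    (G : I -> {poly R}) (n k : nat) :
  (forall i j, (j <= n)%N -> F i j = (G i)`_j) -> (k <= n)%N ->
  (\prod_(i <- r) F i) k = (\prod_(i <- r) G i)`_k.
Proof.
move=> FG; elim: r k => [|i r IHr] k k_le; first by rewrite !big_nil coef1.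
rewrite !big_cons fpsM coefM; apply: eq_bigr => -[j /= j_lt] _.
by rewrite IHr ?FG //; lia.
Qed.

(** The substitution f(X^b). *)
Definition fps_comp_Xn (R : fieldType) (b : nat) (f : fps R) : fps R :=
  fun n => if (b %| n)%N then f (n %/ b)%N else 0.

Lemma fps_comp_XnM (R : fieldType) (b : nat) (f g : fps R) : (0 < b)%N ->
  fps_comp_Xn b (f * g) = fps_comp_Xn b f * fps_comp_Xn b g.
Proof.
move=> b_gt0; apply/funext => n.
have tr (h : fps R) i : (i <= n)%N ->
    fps_comp_Xn b h i = (fps_trunc n h \Po 'X^b)`_i.
  move=> i_le; rewrite coef_comp_poly_Xn // coef_poly /fps_comp_Xn.
  by case: ifP => // _; rewrite ifT // ltnS (leq_trans (leq_div _ _)).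
have -> : fps_comp_Xn b (f * g) n =
    ((fps_trunc n f * fps_trunc n g) \Po 'X^b)`_n.
  rewrite coef_comp_poly_Xn // /fps_comp_Xn; case: ifP => // _.
  by rewrite -[LHS]/(fps_mul f g _) (@fps_mul_trunc _ _ _ n) ?leq_div.
rewrite comp_polyM coefM fpsM; apply: eq_bigr => -[i /= i_lt] _.
by rewrite !tr //; lia.
Qed.

(** * Logarithmic derivatives *)

(** The operator X f', which unlike f' leaves the indices in place. *)
Definition fps_deriv (R : fieldType) (f : fps R) : fps R := fun n => n%:R * f n.

Lemma fps_derivM (R : fieldType) (f g : fps R) :
  fps_deriv (f * g) = fps_deriv f * g + f * fps_deriv g.
Proof.
apply/funext => n; rewrite fpsD !fpsM /fps_deriv fpsM mulr_sumr -big_split.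
apply: eq_bigr => -[i /= i_lt] _.
have -> : n%:R = i%:R + (n - i)%:R :> R by rewrite -natrD subnKC.
by ring.
Qed.

Lemma fps_deriv_comp_Xn (R : fieldType) (b : nat) (f : fps R) :
  fps_deriv (fps_comp_Xn b f) =
  fps_comp_Xn b ((fun n => b%:R * fps_deriv f n) : fps R).
Proof.
apply/funext => n; rewrite /fps_deriv /fps_comp_Xn.
case: ifPn => [/dvdnP[k ->]|_]; last by rewrite mulr0.
have [->|b_gt0] := posnP b; first by rewrite muln0 !mul0r.
by rewrite mulnK // natrM; ring.
Qed.

(** The relation l = X f' / f, stated without division because [f] may have constant coefficient
    0. *)
Definition log_deriv (R : fieldType) (f l : fps R) : Prop :=
  fps_deriv f = l * f.

Lemma log_derivM (R : fieldType) (f g l k : fps R) :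
  log_deriv f l -> log_deriv g k -> log_deriv (f * g) (l + k).
Proof. by rewrite /log_deriv fps_derivM => -> ->; ring. Qed.

Lemma log_deriv1 (R : fieldType) : log_deriv (1 : fps R) 0.
Proof.
rewrite /log_deriv mul0r; apply/funext => -[|n]; first exact: mul0r.
exact: mulr0.
Qed.

Lemma log_deriv_prod (R : fieldType) (I : Type) (r : seq I)
    (F L : I -> fps R) :
  (forall i, log_deriv (F i) (L i)) ->
  log_deriv (\prod_(i <- r) F i) (\sum_(i <- r) L i).
Proof.
move=> FL; elim: r => [|i r IHr]; first by rewrite !big_nil; apply: log_deriv1.
by rewrite !big_cons; apply: log_derivM.
Qed.

Lemma log_deriv_comp_Xn (R : fieldType) (b : nat) (f l : fps R) : (0 < b)%N ->
  log_deriv f l ->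
  log_deriv (fps_comp_Xn b f) (fps_comp_Xn b ((fun n => b%:R * l n) : fps R)).
Proof.
rewrite /log_deriv => b_gt0 fl; rewrite -fps_comp_XnM // fps_deriv_comp_Xn fl.
congr fps_comp_Xn; apply/funext => n; rewrite !fpsM mulr_sumr.
by apply: eq_bigr => i _; rewrite mulrA.
Qed.

(** If [a] is the order of [f] and l - k vanishes below [n], the coefficient of index [n + a] of (l
    - k) f is (l - k)_n f_a. *)
Lemma log_deriv_uniq (R : fieldType) (f l k : fps R) :
  f != 0 -> log_deriv f l -> log_deriv f k -> l = k.
Proof.
move=> f_neq0 fl fk.
have f_ex : exists n, f n != 0.
  apply: contrapT => /forallNP f0; move/eqP: f_neq0; apply.
  by apply/funext => n; apply/eqP/negPn/negP/f0.
have [a fa_neq0 a_min] := ex_minnP f_ex.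
have flk : (l - k) * f = 0 by rewrite mulrBl -fl -fk subrr.
apply/subr0_eq/funext => n.
elim/ltn_ind: n => n IHn.
have := congr1 (fun g : fps R => g (n + a)%N) flk.
rewrite fpsM; have n_lt : (n < (n + a).+1)%N by lia.
rewrite (bigD1 (Ordinal n_lt)) //= addKn big1 => [|[i /= i_lt] /eqP in_neq].
  rewrite addr0 => /eqP; rewrite mulf_eq0 (negPf fa_neq0) orbF.
  by move/eqP.
have [i_n|i_n|/esym i_n] := ltngtP i n.
- by rewrite IHn // mul0r.
- suff -> : f (n + a - i)%N = 0 by rewrite mulr0.
  by apply/eqP; apply: contraT => /a_min; lia.
- by case: in_neq; apply: val_inj.
Qed.

Lemma strong_rec (T : Type) (x0 : T) (F : nat -> (nat -> T) -> T) :
  (forall n g h, (forall k, (k < n)%N -> g k = h k) -> F n g = F n h) ->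
  exists g, forall n, g n = F n g.
Proof.
move=> F_ext.
(* [s n] is right at the indices below [n]; its other values do not affect [F n]. *)
pose s := fix s n := if n is m.+1
  then fun k => if (k < m)%N then s m k else F m (s m) else fun=> x0.
exists (fun n => s n.+1 n) => n; rewrite /= ltnn; apply: F_ext => k.
elim: n => // n IHn; rewrite ltnS leq_eqVlt => /predU1P[->|k_lt].
  by rewrite /= ltnn.
by rewrite [LHS]/= k_lt IHn.
Qed.

(** With [a] the order of [f], the coefficient of index [n + a] of the equation determines [l n],
    since f_a is invertible; below index [a] both sides vanish. *)
Lemma log_deriv_exists (R : fieldType) (f : fps R) :
  f != 0 -> exists l, log_deriv f l.
Proof.
move=> f_neq0.
have f_ex : exists n, f n != 0.
  apply: contrapT => /forallNP f0; move/eqP: f_neq0; apply.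
  by apply/funext => n; apply/eqP/negPn/negP/f0.
have [a fa_neq0 a_min] := ex_minnP f_ex.
have f_lt k : (k < a)%N -> f k = 0.
  by move=> k_lt; apply/eqP; apply: contraT => /a_min; lia.
pose F n (g : nat -> R) :=
  ((n + a)%:R * f (n + a)%N - \sum_(k < n) g k * f (n + a - k)%N) / f a.
have [|l lE] := @strong_rec _ 0 F.
  move=> n g h gh; congr ((_ - _) / _); apply: eq_bigr => k _.
  by rewrite gh.
exists l; apply/funext => n; rewrite /fps_deriv fpsM.
have [n_lt|] := ltnP n a.
  by rewrite f_lt // mulr0 big1 // => i _; rewrite f_lt ?mulr0 //; lia.
move=> /subnK <-; move: (n - a)%N => {}n.
rewrite -(big_mkord xpredT (fun i => l i * f (n + a - i)%N)).
rewrite (@big_cat_nat _ _ _ n.+1) //=; last by lia.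
rewrite [X in _ = _ + X]big_nat_cond [X in _ = _ + X]big1 => [|i]; last first.
  by rewrite andbT => /andP[? ?]; rewrite f_lt ?mulr0 //; lia.
by rewrite addr0 big_mkord big_ord_recr /= addKn lE divfK // subrKC.
Qed.

(** * Logarithmic derivatives of polynomials *)

Lemma fps_polyCM (R : fieldType) (c : R) (f : fps R) (n : nat) :
  (fps_of_poly c%:P * f) n = c * f n.
Proof.
rewrite fpsM big_ord_recl /fps_of_poly coefC subn0 big1 ?addr0 // => i _.
by rewrite coefC /= mul0r.
Qed.

Lemma fps_polyXnM (R : fieldType) (d : nat) (f : fps R) (n : nat) :
  (fps_of_poly 'X^d * f) n = if (n < d)%N then 0 else f (n - d)%N.
Proof.
rewrite fpsM /fps_of_poly; case: ltnP => [n_lt|d_le].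
  by rewrite big1 // => -[i /= i_lt] _; rewrite coefXn ltn_eqF ?mul0r //; lia.
rewrite (bigD1 (Ordinal (d_le : (d < n.+1)%N))) //= coefXn eqxx mul1r.
rewrite big1 ?addr0 // => i; rewrite -(inj_eq val_inj) => /negPf i_neq.
by rewrite coefXn i_neq mul0r.
Qed.

(** For d > 0 this is d X^d / (X^d - 1) = - d (X^d + X^(2d) + ...). *)
Lemma log_deriv_Xn_sub1 (R : fieldType) (d : nat) :
  log_deriv (fps_of_poly ('X^d - 1 : {poly R}))
    (fun n => - (d * ((0 < n) && (d %| n)))%N%:R).
Proof.
have [->|d_gt0] := posnP d.
  rewrite expr0 subrr rmorph0 /log_deriv mulr0.
  by apply/funext => n; apply: mulr0.
pose l : fps R := fun n => - (d * ((0 < n) && (d %| n)))%N%:R.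
rewrite -[X in log_deriv _ X]/l /log_deriv mulrC rmorphB rmorph1 /=.
apply/funext => n; rewrite mulrBl mul1r fpsB fps_polyXnM /fps_deriv fpsB.
rewrite /fps_of_poly coefXn -[(1 : fps R) n]/((n == 0%N)%:R) /l.
case: ltngtP => [n_lt|d_lt|->].
- rewrite !sub0r opprK; case: n n_lt => [|n n_lt]; first by rewrite mul0r muln0.
  by rewrite oppr0 mulr0 gtnNdvd // muln0.
- have n_gt0 : (0 < n)%N by lia.
  rewrite dvdn_subl ?(ltnW d_lt) // subn_gt0 d_lt n_gt0 subrr gtn_eqF //.
  by rewrite subr0 mulr0.
- rewrite subnn d_gt0 dvdnn /= muln0 muln1 gtn_eqF // subr0 mulr1.
  by rewrite opprK oppr0 add0r.
Qed.

(** The quotient X / (X - a) is - sum_(n > 0) a^(-n) X^n if a != 0, and 1 if a = 0; the formula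
    covers a = 0 because the inverse of 0 is 0 by convention. *)
Lemma log_deriv_XsubC (R : fieldType) (a : R) :
  exists2 l, log_deriv (fps_of_poly ('X - a%:P)) l
    & forall n, (0 < n)%N -> l n = - a ^- n.
Proof.
pose l : fps R := fun n => if n == 0%N then (a == 0)%:R else - a ^- n.
exists l; last by case.
rewrite /log_deriv mulrC rmorphB /= -['X]expr1 mulrBl.
apply/funext => n; rewrite fpsB fps_polyCM fps_polyXnM /fps_deriv fpsB.
rewrite /fps_of_poly coefXn coefC /l.
have [->|a_neq0] := eqVneq a 0; case: n => [|[|n]] /=;
  rewrite ?subn1 /= ?expr0 ?expr1.
- by rewrite !mul0r !subr0.
- by rewrite mul0r !subr0 mulr1.
- by rewrite subr0 mulr0 mul0r subr0 expr0n invr0 oppr0.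
- by rewrite mul0r mulr0 subr0.
- by rewrite subr0 mulr1 mulrN divff // sub0r opprK.
- by rewrite subr0 mulr0 (exprS a n.+1) invfM mulrN mulVKf // opprK addNr.
Qed.

Lemma log_deriv_poly (R : fieldType) (c : R) (rs : seq R) :
  exists2 l, log_deriv (fps_of_poly (c *: \prod_(a <- rs) ('X - a%:P))) l
    & forall n, (0 < n)%N -> l n = - \sum_(a <- rs) a ^- n.
Proof.
have /choice[L LP] : forall a : R, exists l,
    log_deriv (fps_of_poly ('X - a%:P)) l /\
    forall n, (0 < n)%N -> l n = - a ^- n.
  by move=> a; have [l] := log_deriv_XsubC a; exists l.
exists (\sum_(a <- rs) L a) => [|n n_gt0]; last first.
  by rewrite fps_sum -sumrN; apply: eq_bigr => a _; apply: (LP a).2.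
have := log_deriv_prod rs (fun a => (LP a).1); rewrite /log_deriv -rmorph_prod => EL.
rewrite -mul_polyC rmorphM /= mulrCA -EL; apply/funext => n.
by rewrite fps_polyCM /fps_deriv fps_polyCM mulrCA.
Qed.

(** * Cyclotomic factors *)

Definition prod_Xn_sub1 (s : seq nat) : {poly int} := \prod_(d <- s) ('X^d - 1).

(** Strong induction, solving X^k - 1 = prod_(d | k) ['Phi_d] for ['Phi_k]. The sizes reflect orders
    of vanishing at 1: each X^d - 1 has a simple root there, and ['Phi_1] is the only cyclotomic
    polynomial vanishing there. *)
Lemma Cyclotomic_prod_Xn_sub1 (k : nat) : (0 < k)%N ->
  exists s t, [/\ all (leq 1) s, all (leq 1) t,
    'Phi_k * prod_Xn_sub1 s = prod_Xn_sub1 t & size t = (size s + (k == 1))%N].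
Proof.
elim/ltn_ind: k => k IHk k_gt0.
have prodD r : {subset r <= divisors k} -> k \notin r -> uniq r ->
    exists s t, [/\ all (leq 1) s, all (leq 1) t,
      (\prod_(d <- r) 'Phi_d) * prod_Xn_sub1 s = prod_Xn_sub1 t
      & size t = (size s + (1%N \in r))%N].
  elim: r => [|d r IHr] r_k k_r r_uniq.
    by exists [::], [::]; rewrite /prod_Xn_sub1 !big_nil mulr1.
  move: k_r r_uniq; rewrite inE negb_or => /andP[dk k_r] /= /andP[d_r r_uniq].
  have [e er|s [t [s_gt0 t_gt0 st size_t]]] := IHr _ k_r r_uniq.
    by apply: r_k; rewrite inE er orbT.
  have : d \in divisors k by apply: r_k; rewrite inE eqxx.
  rewrite -dvdn_divisors // => d_dvd.
  have d_gt0 := dvdn_gt0 k_gt0 d_dvd.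
  have [|s' [t' [s'_gt0 t'_gt0 st' size_t']]] := IHk d _ d_gt0.
    by rewrite ltn_neqAle eq_sym dk dvdn_leq.
  exists (s' ++ s), (t' ++ t); rewrite !all_cat; split; try exact/andP.
    rewrite /prod_Xn_sub1 !big_cat big_cons /= -!/(prod_Xn_sub1 _) -st -st'.
    by ring.
  rewrite !size_cat size_t size_t' inE (eq_sym 1%N d).
  case: (eqVneq d 1%N) d_r => [-> /negPf-> /=|_ _].
    by rewrite addn0 addnAC.
  by rewrite addn0 addnA.
have [d|||s [t [s_gt0 t_gt0 st size_t]]] := prodD (rem k (divisors k)).
- exact: mem_rem.
- by rewrite mem_rem_uniqF ?divisors_uniq.
- by rewrite rem_uniq ?divisors_uniq.
(* Dividing X^k - 1 by the product over the other divisors exchanges the two lists. *)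
exists t, (k :: s); split => //=; first by rewrite k_gt0.
  rewrite /prod_Xn_sub1 big_cons -!/(prod_Xn_sub1 _) -st -prod_Cyclotomic //.
  by rewrite (perm_big _ (perm_to_rem (divisors_id k_gt0))) big_cons mulrA.
rewrite size_t mem_rem_uniq ?divisors_uniq // !inE -dvdn_divisors // dvd1n andbT.
by rewrite eq_sym; case: eqVneq; lia.
Qed.

Definition torsion (z : algC) : Prop := exists2 k : nat, (0 < k)%N & z ^+ k = 1.

(** ['Phi_k] is the minimal polynomial of [z] over the rationals; being monic, it divides [Q] over
    the integers. *)
Lemma Cyclotomic_dvd_root (Q : {poly int}) (k : nat) (z : algC) :
  k.-primitive_root z -> root (map_poly intr Q) z ->
  exists Q', Q = 'Phi_k * Q'.
Proof.
move=> z_prim Qz.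
have [p [pE p_monic] dvdp_root] := minCpolyP z.
have p_cyc : map_poly (intr : int -> rat) 'Phi_k = p.
  apply: (map_inj_poly (fmorph_inj (ratr : rat -> algC)) (rmorph0 _)).
  rewrite -pE (minCpoly_cyclotomic z_prim) -(Cintr_Cyclotomic z_prim) -map_poly_comp.
  by apply: eq_map_poly => x /=; rewrite ratr_int.
have : root (map_poly ratr (map_poly (intr : int -> rat) Q)) z.
  rewrite -map_poly_comp (_ : map_poly _ Q = map_poly intr Q) //.
  by apply: eq_map_poly => x /=; rewrite ratr_int.
rewrite dvdp_root -p_cyc dvdp_rat_int => /dvdpP_int[Q' ->].
by exists Q'; rewrite zprimitive_monic // Cyclotomic_monic.
Qed.

(** Cyclotomic factors are split off one at a time, by induction on the size. If Q(1) != 0, ['Phi_1]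
    is never among them, whence equal sizes. *)
Lemma cyclotomic_part (Q : {poly int}) : Q != 0 -> exists s t Q2,
  [/\ all (leq 1) s, all (leq 1) t, Q * prod_Xn_sub1 s = prod_Xn_sub1 t * Q2,
     Q2 != 0 /\ (forall z : algC, root (map_poly intr Q2) z -> ~ torsion z)
   & Q.[1] != 0 -> size s = size t].
Proof.
have [n] := ubnP (size Q); elim: n Q => // n IHn Q size_Q Q_neq0.
have [nt|] := pselect (forall z : algC, root (map_poly intr Q) z -> ~ torsion z).
  by exists [::], [::], Q; rewrite /prod_Xn_sub1 !big_nil mul1r mulr1; split.
move=> /existsNP[z] /not_implyP[Qz] /contrapT[j j_gt0 zj].
have [k z_prim _] := prim_order_exists j_gt0 zj.
have k_gt0 := prim_order_gt0 z_prim.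
have [Q' QE] := Cyclotomic_dvd_root z_prim Qz.
have Q'_neq0 : Q' != 0 by apply: contraNneq Q_neq0 => Q'0; rewrite QE Q'0 mulr0.
have [|s [t [Q2 [s_gt0 t_gt0 st Q2P size_st]]]] := IHn Q' _ Q'_neq0.
  move: size_Q; rewrite QE size_monicM ?Cyclotomic_monic // size_Cyclotomic.
  have := totient_gt0 k; rewrite k_gt0; lia.
have [s' [t' [s'_gt0 t'_gt0 st' size_st']]] := Cyclotomic_prod_Xn_sub1 k_gt0.
exists (s' ++ s), (t' ++ t), Q2; rewrite !all_cat; split => //; try exact/andP.
  rewrite /prod_Xn_sub1 !big_cat /= -!/(prod_Xn_sub1 _) -st' QE -!mulrA -st.
  by ring.
rewrite QE hornerM mulf_eq0 negb_or => /andP[Phi1 /size_st Q's].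
rewrite !size_cat Q's size_st';
case: (eqVneq k 1%N) Phi1 => [->|_ _]; last by rewrite addn0.
have := prod_Cyclotomic (ltn0Sn 0); rewrite (_ : divisors 1 = [:: 1%N]) //.
by rewrite big_seq1 => ->; rewrite !hornerE ?expr1n subrr eqxx.
Qed.

(** * Exponential sums *)

(** [x] is an exponential sum and [t] its total coefficient at the ratio 1. Ratios may repeat in
    [g]; that [t] depends only on [x] is [unit_part_uniq]. *)
Definition unit_part (x : nat -> algC) (t : algC) : Prop :=
  exists2 g : seq (algC * algC),
    forall j, x j = \sum_(cz <- g) cz.1 * cz.2 ^+ j
    & t = \sum_(cz <- g | cz.2 == 1) cz.1.

Lemma unit_part_ext (x y : nat -> algC) (t : algC) :
  x =1 y -> unit_part x t -> unit_part y t.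
Proof. by move=> /funext ->. Qed.

Lemma unit_partD (x y : nat -> algC) (t u : algC) :
  unit_part x t -> unit_part y u -> unit_part (fun j => x j + y j) (t + u).
Proof.
move=> [g xE tE] [h yE uE]; exists (g ++ h) => [j|]; rewrite big_cat /=.
  by rewrite xE yE.
by rewrite tE uE.
Qed.

Lemma unit_part_geom (c z : algC) :
  unit_part (fun j => c * z ^+ j) (if z == 1 then c else 0).
Proof.
exists [:: (c, z)] => [j|]; first by rewrite big_seq1.
by rewrite big_cons big_nil /= addr0.
Qed.

Lemma unit_part_cst (c : algC) : unit_part (fun=> c) c.
Proof.
have := unit_part_geom c 1; rewrite eqxx; congr unit_part.
by apply/funext => j; rewrite expr1n mulr1.
Qed.

Lemma unit_partZ (c : algC) (x : nat -> algC) (t : algC) :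
  unit_part x t -> unit_part (fun j => c * x j) (c * t).
Proof.
move=> [g xE tE]; exists [seq (c * cz.1, cz.2) | cz <- g] => [j|].
  by rewrite xE mulr_sumr big_map; apply: eq_bigr => cz _; rewrite mulrA.
by rewrite tE mulr_sumr big_map.
Qed.

Lemma unit_partB (x y : nat -> algC) (t u : algC) :
  unit_part x t -> unit_part y u -> unit_part (fun j => x j - y j) (t - u).
Proof.
move=> xt /(@unit_partZ (-1)) yu; have := unit_partD xt yu; rewrite mulN1r.
by congr unit_part; apply/funext => j; rewrite mulN1r.
Qed.

Lemma unit_part_sum (I : Type) (r : seq I) (P : pred I) (x : I -> nat -> algC)
    (t : I -> algC) :
  (forall i, P i -> unit_part (x i) (t i)) ->
  unit_part (fun j => \sum_(i <- r | P i) x i j) (\sum_(i <- r | P i) t i).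
Proof.
move=> xt; elim: r => [|i r IHr].
  have := unit_part_cst 0; rewrite big_nil; congr unit_part.
  by apply/funext => j; rewrite big_nil.
rewrite big_cons; case: ifPn => Pi.
  have := unit_partD (xt i Pi) IHr; congr unit_part.
  by apply/funext => j; rewrite big_cons Pi.
move: IHr; congr unit_part.
by apply/funext => j; rewrite big_cons (negPf Pi).
Qed.

(* Evaluating against the polynomial vanishing at all the ratios other than 1
   isolates the coefficient of the ratio 1. *)
Lemma unit_part0 (t : algC) : unit_part (fun=> 0) t -> t = 0.
Proof.
move=> [g gE ->].
pose p := \prod_(cz <- g | cz.2 != 1) ('X - cz.2%:P).
have p1 : p.[1] != 0.
  rewrite horner_prod prodf_seq_neq0; apply/allP => cz _; apply/implyP => cz1.
  by rewrite !hornerE subr_eq0 eq_sym.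
have pz cz : cz \in g -> cz.2 != 1 -> p.[cz.2] = 0.
  move=> cz_g cz1; rewrite horner_prod (big_rem cz) //= cz1.
  by rewrite !hornerE subrr mul0r.
apply: (mulfI p1); rewrite mulr0.
transitivity (\sum_(cz <- g) cz.1 * p.[cz.2]).
  rewrite mulr_sumr big_mkcond /=; apply: eq_big_seq => cz cz_g.
  by case: eqVneq => [->|cz1]; [rewrite mulrC | rewrite pz ?mulr0].
(* Expanding [p] in powers gives a combination of values of the exponential sum, all of them 0. *)
under eq_bigr do rewrite horner_coef mulr_sumr.
rewrite exchange_big big1 //= => i _.
under eq_bigr do rewrite mulrCA.
by rewrite -mulr_sumr -gE mulr0.
Qed.

Lemma unit_part_uniq (x : nat -> algC) (t u : algC) :
  unit_part x t -> unit_part x u -> t = u.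
Proof.
move=> xt xu; apply/subr0_eq/unit_part0; have := unit_partB xt xu.
by congr unit_part; apply/funext => j; rewrite subrr.
Qed.

(* Along [n * (1 + N * j)] the equation expresses [l] recursively as an
   exponential sum in [j], since [b ord0] is the smallest [b i]; then [l' n] is
   the coefficient of the ratio 1 in that sum. *)
Lemma extract_unit_part (m : nat) (b : 'I_m.+1 -> nat) (w : 'I_m.+1 -> algC)
    (N : nat) (l C x : nat -> algC) :
  (forall i, 0 < b i)%N -> (forall i, i != ord0 -> b ord0 < b i)%N ->
  w ord0 != 0 -> (forall i, b i %| N)%N ->
  (forall n j, C (n * (1 + N * j))%N = C n) ->
  (forall n, (0 < n)%N -> unit_part (fun j => x (n * (1 + N * j))%N) 0) ->
  (forall n, (0 < n)%N ->
     \sum_(i | (b i %| n)%N) w i * l (n %/ b i)%N = C n + x n) ->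
  exists l', forall n, (0 < n)%N ->
     \sum_(i | (b i %| n)%N) w i * l' (n %/ b i)%N = C n.
Proof.
move=> b_gt0 b_gt w0 bN CN xN lE.
(* [b i] divides [N], so 1 + N j is prime to [b i]. *)
have b_dvd i n j : (b i %| n * (1 + N * j))%N = (b i %| n)%N.
  by rewrite Gauss_dvdl // (coprime_dvdl (dvdn_mulr j (bN i))) // coprimenS.
have lE' n j : (0 < n)%N ->
    \sum_(i | (b i %| n)%N) w i * l ((n %/ b i) * (1 + N * j))%N =
    C n + x (n * (1 + N * j))%N.
  move=> n_gt0; rewrite -[C n](CN n j) -lE ?muln_gt0 ?n_gt0 //.
  apply: eq_big => [i|i bi]; first by rewrite b_dvd.
  by rewrite divn_mulAC.
have l_ex n : (0 < n)%N -> exists t, unit_part (fun j => l (n * (1 + N * j))%N) t.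
  elim/ltn_ind: n => n IHn n_gt0.
  (* At the index [b ord0 * n] the term of [ord0] is [l] at [n]; the other terms have indices below
     [n]. *)
  have bn_gt0 : (0 < b ord0 * n)%N by rewrite muln_gt0 b_gt0.
  have /choice[t tP] i : exists t, ((b i %| b ord0 * n)%N && (i != ord0)) ->
      unit_part (fun j => l ((b ord0 * n) %/ b i * (1 + N * j))%N) t.
    case: (boolP (_ && _)) => [/andP[bi i0]|_]; last by exists 0.
    have [||t tP] := IHn (b ord0 * n %/ b i)%N; last by exists t.
    - by rewrite ltn_divLR // mulnC ltn_pmul2l // b_gt.
    - by rewrite divn_gt0 // dvdn_leq.
  have S := unit_part_sum (index_enum 'I_m.+1) (fun i iP => unit_partZ (w i) (tP i iP)).
  have := unit_partZ (w ord0)^-1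
    (unit_partB (unit_partD (unit_part_cst (C (b ord0 * n)%N)) (xN _ bn_gt0)) S).
  set u := (X in unit_part _ X) => uP; exists u; move: uP; congr unit_part.
  apply/funext => j; rewrite -lE' // (bigD1 ord0) ?dvdn_mulr //= addrK mulKf //.
  by rewrite mulKn.
have /choice[l' l'P] n : exists t,
    (0 < n)%N -> unit_part (fun j => l (n * (1 + N * j))%N) t.
  by case: n => [|n]; [exists 0 | have [//|t] := l_ex n.+1; exists t].
exists l' => n n_gt0; rewrite -[RHS]addr0.
(* Both sides are the coefficient of the ratio 1 in one and the same sequence. *)
apply: (@unit_part_uniq (fun j => C n + x (n * (1 + N * j))%N)); last first.
  exact: unit_partD (unit_part_cst _) (xN _ n_gt0).
apply: (unit_part_ext (fun j => lE' n j n_gt0)).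
apply: (@unit_part_sum _ _ _
  (fun i j => w i * l (n %/ b i * (1 + N * j))%N)) => i bi.
by apply/unit_partZ/l'P; rewrite divn_gt0 // dvdn_leq.
Qed.

(** * The divisor equation *)

Lemma sum_count (R : pzRingType) (r s : seq nat) (G : nat -> R) : uniq r ->
  \sum_(n <- r) (count_mem n s)%:R * G n = \sum_(d <- s | d \in r) G d.
Proof.
move=> r_uniq; elim: s => [|d s IHs].
  by rewrite big_nil big1 // => n _; rewrite mul0r.
rewrite big_cons -IHs; under eq_bigr do rewrite /= natrD mulrDl.
rewrite big_split /=; case: ifPn => dr.
  rewrite (bigD1_seq d) //= eqxx mul1r big1 ?addr0 // => n nd.
  by rewrite eq_sym (negPf nd) mul0r.
rewrite big1_seq ?add0r // => n /= nr.
by case: eqVneq nr dr => [->->|_ _ _] //; rewrite mul0r.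
Qed.

(** Moebius inversion by recursion: the divisor [n] itself determines [y n]. The weights [d] come
    from the logarithmic derivatives of the X^d - 1, so that [y] gives formal exponents of these
    factors, up to sign. *)
Lemma divisor_sum_exists (x : nat -> algC) : exists y : nat -> algC,
  forall n, (0 < n)%N -> x n = \sum_(d <- divisors n) d%:R * y d.
Proof.
pose F n (y : nat -> algC) :=
  (x n - \sum_(d <- divisors n | d != n) d%:R * y d) / n%:R.
have [|y yE] := @strong_rec _ 0 F.
  move=> n g h gh; have [->|n_gt0] := posnP n; first by rewrite /F invr0 !mulr0.
  congr ((_ - _) / _); rewrite big_seq_cond [RHS]big_seq_cond.
  apply: eq_bigr => d /andP[]; rewrite -dvdn_divisors // => dn d_neq.
  by rewrite gh // ltn_neqAle d_neq dvdn_leq.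
exists y => n n_gt0; rewrite (bigD1_seq n) ?divisors_uniq ?divisors_id //= yE.
by rewrite /F [_ * (_ / _)]mulrC divfK ?subrK // pnatr_eq0 -lt0n.
Qed.

Lemma divisor_sum_inj (F : nat -> algC) :
  (forall n, (0 < n)%N -> \sum_(d <- divisors n) F d = 0) ->
  forall n, (0 < n)%N -> F n = 0.
Proof.
move=> F0; elim/ltn_ind => n IHn n_gt0; have := F0 n n_gt0.
rewrite (bigD1_seq n) ?divisors_uniq ?divisors_id //= big_seq_cond big1 ?addr0 //.
move=> d /andP[]; rewrite -dvdn_divisors // => dn d_neq.
by rewrite IHn ?(dvdn_gt0 n_gt0 dn) // ltn_neqAle d_neq dvdn_leq.
Qed.

(** The divisors of [n] that are multiples of [b] are the b d with d dividing n / b. *)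
Lemma divisor_sum_dilate (b n : nat) (G : nat -> algC) :
  (0 < b)%N -> (0 < n)%N ->
  \sum_(d <- divisors n | (b %| d)%N) G d =
  if (b %| n)%N then \sum_(d <- divisors (n %/ b)) G (b * d)%N else 0.
Proof.
move=> b_gt0 n_gt0; case: ifPn => [bn|nb]; last first.
  rewrite big_seq_cond big_pred0 // => d; rewrite -dvdn_divisors //.
  apply/negP => /andP[dn bd]; case/negP: nb; exact: dvdn_trans dn.
have nb_gt0 : (0 < n %/ b)%N by rewrite divn_gt0 // dvdn_leq.
rewrite -[LHS]big_filter -(big_map (muln b) xpredT G); apply/perm_big/uniq_perm.
- by rewrite filter_uniq ?divisors_uniq.
- rewrite map_inj_uniq ?divisors_uniq // => d d' /eqP.
  by rewrite eqn_pmul2l // => /eqP.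
move=> d; rewrite mem_filter -dvdn_divisors //; apply/andP/mapP.
  move=> [/dvdnP[k ->] kbn]; exists k; last by rewrite mulnC.
  by rewrite -dvdn_divisors // dvdn_divRL.
move=> [k]; rewrite -dvdn_divisors // dvdn_divRL // mulnC => kbn ->.
by rewrite dvdn_mulr.
Qed.

Lemma dilation_eq_finite_support (m : nat) (b : 'I_m.+1 -> nat)
    (w : 'I_m.+1 -> algC) (p D : nat) (y q : nat -> algC) :
  prime p -> (forall i, 0 < b i)%N ->
  (forall i, i != ord0 -> b ord0 < b i)%N ->
  (forall i, i != ord0 -> logn p (b i) < logn p (b ord0))%N ->
  w ord0 != 0 -> (forall n, (D < n)%N -> q n = 0) ->
  (forall n, (0 < n)%N -> \sum_(i | (b i %| n)%N) w i * y (n %/ b i)%N = q n) ->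
  exists K, forall k, (K < k)%N -> y k = 0.
Proof.
move=> p_prime b_gt0 b_gt b_logn w0 qD yE.
pose B := \max_i b i.
have b_le i : (b i <= B)%N by apply: leq_bigmax.
have B_gt0 : (0 < B)%N by apply: leq_trans (b_le ord0).
(* Descent along the indices [b ord0 * k / b i]: they decrease while their p-adic
   valuation increases, so that the number of steps is bounded by the final
   index, which is at most D. *)
have chain k : (0 < k)%N -> y k != 0 -> exists r k',
    [/\ (k' <= D)%N, (logn p k + r <= logn p k')%N & (k <= k' * B ^ r)%N].
  elim/ltn_ind: k => k IHk k_gt0 yk.
  have [k_le|k_gt] := leqP k D.
    by exists 0%N, k; rewrite addn0 expn0 muln1.
  have bk_gt0 : (0 < b ord0 * k)%N by rewrite muln_gt0 b_gt0.
  have := yE _ bk_gt0; rewrite qD; last first.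
    by rewrite (leq_trans k_gt) // leq_pmull.
  rewrite (bigD1 ord0) ?dvdn_mulr //= mulKn // => /eqP; rewrite addr_eq0 => yk'.
  have [i /and3P[bi i0 yi]] : exists i,
      [&& (b i %| b ord0 * k)%N, i != ord0 & y (b ord0 * k %/ b i)%N != 0].
    apply: contrapT => /forallNP none; move: yk'; rewrite big1 => [|i /andP[bi i0]].
      by rewrite oppr0 mulf_eq0 (negPf w0) (negPf yk).
    apply/eqP; rewrite mulf_eq0; apply/orP; right.
    by move: (none i); rewrite bi i0 /= => /negP; rewrite negbK.
  set k1 := (b ord0 * k %/ b i)%N in yi.
  have k1E : (k1 * b i = b ord0 * k)%N by rewrite divnK.
  have k1_gt0 : (0 < k1)%N by rewrite divn_gt0 // dvdn_leq.
  have k1_lt : (k1 < k)%N by rewrite ltn_divLR // mulnC ltn_pmul2l // b_gt.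
  have [r [k' [k'_le logk' k1_le]]] := IHk _ k1_lt k1_gt0 yi.
  exists r.+1, k'; split => //.
    have := congr1 (logn p) k1E; rewrite !lognM // => logE.
    have := b_logn i i0; lia.
  rewrite expnSr mulnA (leq_trans _ (leq_mul k1_le (b_le i))) //.
  by rewrite k1E leq_pmull.
(* A step divides the index by at most [B], and there are at most [D] steps, the valuation of a
   positive k' <= D being less than [D]. *)
exists (D * B ^ D)%N => k k_gt; apply/eqP; apply: contraT => yk.
have k_gt0 : (0 < k)%N by lia.
have [r [k' [k'_le logk' k_le]]] := chain k k_gt0 yk.
have r_le : (r <= D)%N.
  have k'_gt0 : (0 < k')%N by case: k' k_le {k'_le logk'} => //; lia.
  have := ltn_logl p k'_gt0; lia.
suff : (k <= D * B ^ D)%N by lia.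
by rewrite (leq_trans k_le) // leq_mul // leq_pexp2l.
Qed.

(** By Gauss's lemma the primitive part of [E] would divide [P] over the integers, so its value at 1
    would divide 1; but that value is at least 2. *)
Lemma nat_poly_ndvd (E P : {poly int}) (k1 k2 : nat) (F : {poly algC}) :
  (forall k, 0 <= E`_k) -> k1 != k2 -> 0 < E`_k1 -> 0 < E`_k2 -> P.[1] = 1 ->
  map_poly intr E * F != map_poly intr P.
Proof.
move=> E_ge0 k12 E1 E2 P1; apply/eqP => EFP.
have ratE (p : {poly int}) :
    map_poly (intr : int -> algC) p = map_poly ratr (map_poly (intr : int -> rat) p).
  by rewrite -map_poly_comp; apply: eq_map_poly => x /=; rewrite ratr_int.
(* Over the integers [%|] is divisibility up to nonzero constants, that is, over the rationals;
   hence the passage to [zprimitive E]. *)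
have : E %| P.
  by rewrite -dvdp_rat_int -(dvdp_map (ratr : rat -> algC)) -!ratE -EFP dvdp_mulIl.
move=> /dvdpP_int[r PE].
set z := zprimitive E in PE.
have E_neq0 : E != 0 by apply: contraTneq E1 => ->; rewrite coef0 ltxx.
(* The content carries the sign of the leading coefficient. *)
have c_gt0 : 0 < zcontents E.
  rewrite -sgz_gt0 sgz_contents sgz_gt0 lt_def lead_coef_eq0 E_neq0.
  exact: E_ge0.
have zE k : E`_k = zcontents E * z`_k by rewrite {1}(zpolyEprim E) coefZ.
have z_ge0 k : 0 <= z`_k by rewrite -(pmulr_rge0 _ c_gt0) -zE.
have z1_ge1 : 1 <= z`_k1 by have := E1; rewrite zE pmulr_rgt0.
have z2_ge1 : 1 <= z`_k2 by have := E2; rewrite zE pmulr_rgt0.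
have z_size k : 1 <= z`_k -> (k < size z)%N.
  by move=> zk; rewrite ltnNge; apply/negP => /(nth_default 0) z0; rewrite z0 in zk.
have z_ge2 : 2 <= z.[1].
  rewrite horner_coef; under eq_bigr do rewrite expr1n mulr1.
  rewrite (bigD1 (Ordinal (z_size _ z1_ge1))) //=.
  rewrite (bigD1 (Ordinal (z_size _ z2_ge1))) /=; last by rewrite -val_eqE eq_sym.
  rewrite addrA ler_wpDr ?sumr_ge0 //; exact: lerD z1_ge1 z2_ge1.
have : z.[1] * r.[1] = 1 by rewrite -hornerM -PE.
have [r_le|r_gt] := lerP r.[1] 0 => zr1.
  have : z.[1] * r.[1] <= 0 by rewrite mulr_ge0_le0 // (le_trans _ z_ge2).
  by rewrite zr1.
have : z.[1] <= z.[1] * r.[1] by rewrite ler_peMr // (le_trans _ z_ge2).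
by rewrite zr1 => /(le_trans z_ge2).
Qed.

Lemma sum_multiples (V : nmodType) (b K M : nat) (F : nat -> V) :
  (0 < b)%N -> (b * K < M)%N -> (forall k, (K < k)%N -> F (b * k)%N = 0) ->
  \sum_(1 <= n < M | (b %| n)%N) F n = \sum_(1 <= k < K.+1) F (b * k)%N.
Proof.
move=> b_gt0 bK F0.
rewrite (bigID (fun n => n %/ b <= K)%N) /= [X in _ + X]big1 => [|n /andP[]].
  rewrite addr0 -big_filter -(big_map (muln b) xpredT F).
  apply/perm_big/uniq_perm; first by rewrite filter_uniq ?iota_uniq.
    rewrite map_inj_uniq ?iota_uniq // => d d' /eqP.
    by rewrite eqn_pmul2l // => /eqP.
  move=> n; rewrite mem_filter mem_index_iota; apply/idP/mapP.
    move=> /andP[/andP[/dvdnP[k ->]]]; rewrite mulnK // => k_le /andP[bk _].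
    exists k; last by rewrite mulnC.
    by rewrite mem_index_iota ltnS k_le andbT; case: k bk {k_le}.
  move=> [k]; rewrite mem_index_iota => /andP[k_gt0 k_le] ->.
  rewrite dvdn_mulr // mulKn // -ltnS k_le muln_gt0 b_gt0 k_gt0 /=.
  by rewrite (leq_ltn_trans _ bK) // leq_mul2l -ltnS k_le orbT.
by move=> /dvdnP[k ->]; rewrite mulnK // -ltnNge mulnC; apply: F0.
Qed.

(** The p-adic valuation turns products of indices into products of monomials: multiplying the
    equation at [n] by X^(v(n)) and summing over [n] gives E F = P with P(1) = size s - size t =
    1. *)
Lemma dilation_eq_no_solution (m : nat) (b e : 'I_m.+1 -> nat) (p : nat)
    (s t : seq nat) (y : nat -> algC) :
  (1 <= m)%N -> prime p -> (forall i, 0 < b i)%N -> (forall i, 0 < e i)%N ->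
  (forall i, i != ord0 -> b ord0 < b i)%N ->
  (forall i, i != ord0 -> logn p (b i) < logn p (b ord0))%N ->
  all (leq 1) s -> all (leq 1) t -> size s = (size t).+1 ->
  ~ (forall n, (0 < n)%N ->
      \sum_(i | (b i %| n)%N) (e i)%:R * y (n %/ b i)%N =
      (count_mem n s)%:R - (count_mem n t)%:R).
Proof.
move=> m_ge1 p_prime b_gt0 e_gt0 b_gt b_logn s_gt0 t_gt0 size_st yE.
(* [D] bounds every entry of [s] and of [t]. *)
pose D := (\sum_(d <- s) d + \sum_(d <- t) d)%N.
have count0 n : (D < n)%N -> (count_mem n s = 0 /\ count_mem n t = 0)%N.
  move=> n_gt; split; apply/count_memPn/negP => n_in; move: n_gt.
    by rewrite /D (big_rem n) //=; lia.
  by rewrite /D [X in (_ + X)%N](big_rem n) //=; lia.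
have [|||K yK] := @dilation_eq_finite_support m b (fun i => (e i)%:R) p D y
  (fun n => (count_mem n s)%:R - (count_mem n t)%:R) p_prime b_gt0 b_gt b_logn.
- by rewrite pnatr_eq0 -lt0n.
- by move=> n /count0[-> ->]; rewrite subrr.
- exact: yE.
(* Summing over n < M reaches every entry of [s] and [t] and every index b_i k with k <= K. *)
pose M := (D + (\max_i b i) * K).+1.
have bK i : (b i * K < M)%N.
  have b_le : (b i <= \max_i b i)%N by apply: leq_bigmax.
  by rewrite /M ltnS (leq_trans (leq_mul b_le (leqnn K))) // leq_addl.
pose E : {poly int} := \sum_i (e i)%:R *: 'X^(logn p (b i)).
pose P : {poly int} := \sum_(d <- s) 'X^(logn p d) - \sum_(d <- t) 'X^(logn p d).
pose F : {poly algC} := \sum_(1 <= k < K.+1) y k *: 'X^(logn p k).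
have coefE k : E`_k = \sum_i (e i * (k == logn p (b i)))%:R.
  rewrite coef_sum; apply: eq_bigr => i _; rewrite coefZ coefXn natrM.
  by case: eqP.
have E_pos i : 0 < E`_(logn p (b i)).
  rewrite coefE (bigD1 i) //= eqxx muln1 ltr_wpDr ?ltr0n ?e_gt0 //.
  by apply: sumr_ge0 => j _; apply: ler0n.
have one_neq0 : inord 1 != ord0 :> 'I_m.+1.
  by rewrite -val_eqE /= inordK.
suff : map_poly intr E * F = map_poly intr P.
  apply/eqP/(@nat_poly_ndvd _ _ (logn p (b ord0)) (logn p (b (inord 1)))) => //.
  - by move=> k; rewrite coefE; apply: sumr_ge0 => i _; apply: ler0n.
  - by rewrite gtn_eqF // b_logn.
  - have sum1 (r : seq nat) : (\sum_(d <- r) 'X^(logn p d)).[1] = (size r)%:R :> int.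
      rewrite horner_sum -sum1_size natr_sum.
      by apply: eq_bigr => d _; rewrite hornerXn expr1n.
    by rewrite hornerD hornerN !sum1 size_st mulrS addrK.
have sumP (r : seq nat) : all (leq 1) r ->
    (forall n, (D < n)%N -> count_mem n r = 0%N) ->
    \sum_(1 <= n < M) (count_mem n r)%:R * 'X^(logn p n) =
    \sum_(d <- r) 'X^(logn p d) :> {poly algC}.
  move=> /allP r_gt0 rD; rewrite sum_count ?iota_uniq // big_seq_cond [RHS]big_seq.
  apply: eq_bigl => d; rewrite mem_index_iota; case: (boolP (d \in r)) => //= dr.
  rewrite r_gt0 //= ltnS; apply: leq_trans (leq_addr _ _).
  by rewrite leqNgt; apply/negP => /rD /count_memPn; rewrite dr.
rewrite /P rmorphB !rmorph_sum /=.
under [X in _ = X - _]eq_bigr do rewrite map_polyXn.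
under [X in _ = _ - X]eq_bigr do rewrite map_polyXn.
rewrite -!sumP //; try by move=> n /count0[].
rewrite -sumrB mulr_suml.
transitivity (\sum_(1 <= n < M) \sum_(i | (b i %| n)%N)
   ((e i)%:R * y (n %/ b i)%N) *: 'X^(logn p n) : {poly algC}).
  rewrite (exchange_big_dep xpredT) //=; apply: eq_bigr => i _.
  rewrite (@sum_multiples _ _ K) // => [|k k_gt]; last first.
    by rewrite mulKn // yK // mulr0 scale0r.
  rewrite map_polyZ map_polyXn mulr_sumr big_nat [RHS]big_nat.
  apply: eq_bigr => k /andP[k_gt0 _]; rewrite mulKn // lognM // exprD.
  by rewrite -scalerAl -scalerAr scalerA /= rmorph_nat.
rewrite big_nat [RHS]big_nat; apply: eq_bigr => n /andP[n_gt0 _].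
by rewrite -scaler_suml yE // scalerBl !scaler_nat !mulr_natl.
Qed.

(** The terms of [rs] are removed by [extract_unit_part]; Moebius inversion then reduces the
    equation to [dilation_eq_no_solution]. *)
Lemma log_eq_no_solution (m : nat) (b e : 'I_m.+1 -> nat) (p : nat)
    (s t : seq nat) (rs : seq algC) (l : nat -> algC) :
  (1 <= m)%N -> prime p -> (forall i, 0 < b i)%N -> (forall i, 0 < e i)%N ->
  (forall i, i != ord0 -> b ord0 < b i)%N ->
  (forall i, i != ord0 -> logn p (b i) < logn p (b ord0))%N ->
  all (leq 1) s -> all (leq 1) t -> size s = (size t).+1 ->
  (forall a, a \in rs -> ~ torsion a) ->
  ~ (forall n, (0 < n)%N ->
      \sum_(i | (b i %| n)%N) (e i * b i)%:R * l (n %/ b i)%N =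
      \sum_(d <- s | (d %| n)%N) d%:R - \sum_(d <- t | (d %| n)%N) d%:R
      - \sum_(a <- rs) a ^- n).
Proof.
move=> m_ge1 p_prime b_gt0 e_gt0 b_gt b_logn s_gt0 t_gt0 size_st rs_nt lE.
(* A common multiple of all moduli, so that passing from n to n (1 + N j) changes no divisibility
   condition. *)
pose N := ((\prod_i b i) * (\prod_(d <- s) d * \prod_(d <- t) d))%N.
pose C n : algC := \sum_(d <- s | (d %| n)%N) d%:R - \sum_(d <- t | (d %| n)%N) d%:R.
have sN d : d \in s -> (d %| N)%N.
  by move=> ds; rewrite dvdn_mull // dvdn_mulr // (big_rem d) //= dvdn_mulr.
have tN d : d \in t -> (d %| N)%N.
  by move=> dt; rewrite dvdn_mull // dvdn_mull // (big_rem d) //= dvdn_mulr.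
have dvdN d n j : (d %| N)%N -> (d %| n * (1 + N * j))%N = (d %| n)%N.
  by move=> dN; rewrite Gauss_dvdl // (coprime_dvdl (dvdn_mulr j dN)) // coprimenS.
have N_gt0 : (0 < N)%N.
  have prod_gt0 (r : seq nat) : all (leq 1) r -> (0 < \prod_(d <- r) d)%N.
    by move=> /allP r_gt0; rewrite big_seq prodn_cond_gt0.
  by rewrite /N !muln_gt0 prodn_gt0 // !prod_gt0.
have [|||||l' l'E] := @extract_unit_part m b (fun i => (e i * b i)%:R) N l C
    (fun n => - \sum_(a <- rs) a ^- n) b_gt0 b_gt.
- by rewrite pnatr_eq0 -lt0n muln_gt0 e_gt0 b_gt0.
- by move=> i; rewrite /N dvdn_mulr // (bigD1 i) //= dvdn_mulr.
- have dvd_sum (r : seq nat) n j : (forall d, d \in r -> (d %| N)%N) ->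
      \sum_(d <- r | (d %| n * (1 + N * j))%N) d%:R =
      \sum_(d <- r | (d %| n)%N) d%:R :> algC.
    move=> rN; rewrite big_seq_cond [RHS]big_seq_cond; apply: eq_bigl => d.
    by apply: andb_id2l => /rN dN; rewrite dvdN.
  by move=> n j; rewrite /C !dvd_sum.
- move=> n n_gt0.
  have S : unit_part (fun j => \sum_(a <- rs | a \in rs) a ^- (n * (1 + N * j)))
      (\sum_(a <- rs | a \in rs) 0).
    apply: (@unit_part_sum _ _ _ (fun a j => a ^- (n * (1 + N * j)))) => a a_rs.
    (* As a function of j the term is geometric of ratio a^(-nN), which is not 1 because [a] is not
       a root of unity. *)
    have := unit_part_geom (a ^- n) (a ^- (n * N)); case: eqVneq => [a1|_].
      case: (rs_nt a a_rs); exists (n * N)%N; first by rewrite muln_gt0 n_gt0.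
      by rewrite -[LHS]invrK a1 invr1.
    apply: unit_part_ext => j; rewrite mulnDr muln1 mulnA exprD invfM.
    by rewrite [in RHS]exprM exprVn.
  have := unit_partB (unit_part_cst 0) S; rewrite big1 // subr0.
  by apply: unit_part_ext => j; rewrite sub0r -big_seq.
- by move=> n n_gt0; rewrite lE.
have [y yE] := divisor_sum_exists l'.
apply: (@dilation_eq_no_solution m b e p s t y) => // n n_gt0.
apply/eqP; rewrite -subr_eq0; apply/eqP.
(* The defect of the desired equation: the sums of k W(k) over divisors vanish, hence so does
   [W]. *)
pose W n := \sum_(i | (b i %| n)%N) (e i)%:R * y (n %/ b i)%N -
  ((count_mem n s)%:R - (count_mem n t)%:R).
have nW0 k : (0 < k)%N -> k%:R * W k = 0; last first.
  have /eqP := nW0 n n_gt0; rewrite mulf_eq0 pnatr_eq0 eqn0Ngt n_gt0 /=.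
  by move/eqP.
move: k; apply: divisor_sum_inj => k k_gt0.
have CE (r : seq nat) : \sum_(d <- divisors k) d%:R * (count_mem d r)%:R =
    \sum_(d <- r | (d %| k)%N) d%:R :> algC.
  under eq_bigr do rewrite mulrC.
  rewrite sum_count ?divisors_uniq //; apply: eq_bigl => d.
  by rewrite -dvdn_divisors.
rewrite /W; under eq_bigr do rewrite !mulrBr.
rewrite !sumrB !CE -[X in _ - X]/(C k) -l'E //; apply/eqP; rewrite subr_eq0; apply/eqP.
under eq_bigr do rewrite mulr_sumr.
rewrite (exchange_big_dep xpredT) //= [RHS]big_mkcond.
apply: eq_bigr => i _; rewrite divisor_sum_dilate //; case: ifP => // bk.
have k_div : (0 < k %/ b i)%N by rewrite divn_gt0 // dvdn_leq.
(* The weight b_i is absorbed here: b_i d is the divisor that appears after dilation. *)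
rewrite (yE _ k_div) [RHS]mulr_sumr; apply: eq_bigr => d _.
by rewrite mulKn // !natrM; ring.
Qed.

(** * The generating function *)

Lemma log_deriv_prod_Xn_sub1 (s : seq nat) :
  exists2 l, log_deriv
    (fps_of_poly (map_poly (intr : int -> algC) (prod_Xn_sub1 s))) l
    & forall n, (0 < n)%N -> l n = - \sum_(d <- s | (d %| n)%N) d%:R.
Proof.
pose L d : fps algC := fun n => - (d * ((0 < n) && (d %| n)))%N%:R.
exists (\sum_(d <- s) L d) => [|n n_gt0]; last first.
  rewrite fps_sum -sumrN [RHS]big_mkcond; apply: eq_bigr => d _.
  by rewrite /L n_gt0 /=; case: (d %| n)%N; rewrite ?muln1 ?muln0 ?oppr0.
rewrite rmorph_prod rmorph_prod; apply: log_deriv_prod => d /=.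
by rewrite rmorphB rmorph1 /= map_polyXn; apply: log_deriv_Xn_sub1.
Qed.

(** The weight e_i counts the equal factors f(X^(b_i)); b_i comes from the chain rule. *)
Lemma log_deriv_prod_comp_Xn (R : fieldType) (m : nat) (b e : 'I_m.+1 -> nat)
    (f l : fps R) : (forall i, 0 < b i)%N -> log_deriv f l ->
  exists2 L, log_deriv
    (\prod_(ij : {i : 'I_m.+1 & 'I_(e i)}) fps_comp_Xn (b (tag ij)) f) L
    & forall n, L n = \sum_(i | (b i %| n)%N) (e i * b i)%:R * l (n %/ b i)%N.
Proof.
move=> b_gt0 lE; pose L i := fps_comp_Xn (b i) ((fun n => (b i)%:R * l n) : fps R).
exists (\sum_(ij : {i : 'I_m.+1 & 'I_(e i)}) L (tag ij)) => [|n].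
  by apply: log_deriv_prod => ij; apply: log_deriv_comp_Xn.
rewrite fps_sum [RHS]big_mkcond.
rewrite -(sig_big_dep xpredT (fun i => xpredT) (fun i (_ : 'I_(e i)) => L i n)).
apply: eq_bigr => i _; rewrite sumr_const card_ord /L /fps_comp_Xn.
by case: ifP => _; rewrite ?mul0rn // -mulrnAl -mulrnA mulnC.
Qed.

Lemma prod_Xn_sub1_neq0 (s : seq nat) : all (leq 1) s -> prod_Xn_sub1 s != 0.
Proof.
move=> /allP s_gt0; rewrite prodf_seq_neq0; apply/allP => d ds /=.
by rewrite -size_poly_eq0 size_XnsubC ?s_gt0.
Qed.

Definition fps_set (A : set nat) : fps algC := fun n => `[< A n >]%:R.

(** Expanding the product yields one monomial for each choice of the entries. As the b_i are
    positive, entries above [n] cannot contribute, so finitely many choices suffice. *)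
Lemma rep_fun_coef (m : nat) (b e : 'I_m.+1 -> nat) (A : set nat) (n : nat) :
  (forall i, 0 < b i)%N ->
  (rep_fun b e A n)%:R =
  (\prod_(ij : {i : 'I_m.+1 & 'I_(e i)})
     fps_comp_Xn (b (tag ij)) (fps_set A)) n.
Proof.
move=> b_gt0; set IJ := ({i : 'I_m.+1 & 'I_(e i)}).
(* The factor f(X^(b_i)) cut down to the entries a <= n. *)
pose G (ij : IJ) : {poly algC} :=
  \sum_(a < n.+1) `[< A a >]%:R *: 'X^(b (tag ij) * a).
rewrite (@fps_prod_coef _ _ _ _ G n) // => [|ij k k_le]; last first.
  rewrite coef_sum /fps_comp_Xn /fps_set; case: ifPn => [/dvdnP[j kE]|nb].
    have b_ij := b_gt0 (tag ij).
    have j_lt : (j < n.+1)%N.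
      by rewrite ltnS (leq_trans _ k_le) // kE leq_pmulr.
    rewrite (bigD1 (Ordinal j_lt)) //= coefZ coefXn kE mulnK // mulnC eqxx mulr1.
    rewrite big1 ?addr0 // => a; rewrite -val_eqE /= => a_neq.
    by rewrite coefZ coefXn eqn_pmul2l // eq_sym (negPf a_neq) mulr0.
  rewrite big1 // => a _; rewrite coefZ coefXn;
  case: eqVneq => [kE|]; last by rewrite mulr0.
  by case/negP: nb; rewrite kE dvdn_mulr.
rewrite /G bigA_distr_bigA coef_sum /=.
pose good (g : {ffun IJ -> 'I_n.+1}) :=
  [forall ij, `[< A (g ij) >]] && (n == \sum_ij b (tag ij) * g ij)%N.
transitivity (\sum_(g : {ffun IJ -> 'I_n.+1}) (good g)%:R : algC); last first.
  apply: eq_bigr => g _; rewrite /good.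
  rewrite scaler_prod coefZ.
  rewrite -(big_morph (fun k => 'X^k : {poly algC}) (exprD _) (expr0 _)).
  rewrite coefXn; case: forallP => [gA|ngA] /=.
    by rewrite [X in _ = X * _]big1 ?mul1r // => ij _; rewrite gA.
  have [ij nA] : exists ij, ~~ `[< A (g ij) >].
    by apply: contrapT => /forallNP all_A; apply: ngA => ij; apply/negPn/negP.
  by rewrite (bigD1 ij) //= (negPf nA) !mul0r.
rewrite -natr_sum -big_mkcond sum1_card; congr _%:R.
pose lift (g : {ffun IJ -> 'I_n.+1}) : {ffun IJ -> nat} := [ffun ij => val (g ij)].
have lift_inj : injective lift.
  move=> g h /ffunP gh; apply/ffunP => ij.
  by apply: val_inj; have := gh ij; rewrite !ffunE.
(* The choices satisfying [good] and the representations correspond through [lift]. *)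
rewrite /rep_fun cardE -(size_map lift); apply/perm_size/uniq_perm.
- exact: fset_uniq.
- by rewrite map_inj_uniq ?enum_uniq.
have sumE (a : {ffun IJ -> nat}) :
    (\sum_(i < m.+1) b i * \sum_(j < e i) a (Tagged (fun i => 'I_(e i)) j) =
     \sum_ij b (tag ij) * a ij)%N.
  transitivity (\sum_(i < m.+1) \sum_(j < e i)
      b i * a (Tagged (fun i => 'I_(e i)) j))%N.
    by apply: eq_bigr => i _; rewrite big_distrr.
  by rewrite sig_big_dep; apply: eq_bigr => -[].
move=> a; rewrite in_fset_set; last exact: finite_representations.
apply/idP/mapP => [/set_mem[aA nE]|[g]].
  rewrite sumE in nE.
  have a_lt ij : (a ij < n.+1)%N.
    rewrite ltnS nE (bigD1 ij) //= (leq_trans _ (leq_addr _ _)) //.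
    by rewrite leq_pmull.
  exists [ffun ij => Ordinal (a_lt ij)]; last by apply/ffunP => ij; rewrite !ffunE.
  rewrite mem_enum unfold_in; apply/andP; split.
    by apply/forallP => ij; rewrite ffunE; apply/asboolP/aA.
  by rewrite {1}nE; apply/eqP/eq_bigr => ij _; rewrite ffunE.
rewrite mem_enum unfold_in => /andP[/forallP gA /eqP nE] ->; apply: mem_set.
split=> [ij|]; first by rewrite ffunE; apply/asboolP/gA.
by rewrite sumE {1}nE; apply: eq_bigr => ij _; rewrite ffunE.
Qed.

Lemma rep_fun_gt0 (m : nat) (b e : 'I_m.+1 -> nat) (A : set nat) (x : nat) :
  (forall i, 0 < b i)%N -> A x ->
  (0 < rep_fun b e A (\sum_i b i * (e i * x)))%N.
Proof.
move=> b_gt0 Ax; rewrite /rep_fun cardfs_gt0; apply/fset0Pn.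
exists [ffun=> x]; rewrite in_fset_set; last exact: finite_representations.
apply: mem_set; split=> [ij|]; first by rewrite ffunE.
apply: eq_bigr => i _; congr (_ * _)%N.
by under eq_bigr do rewrite ffunE; rewrite sum_nat_const card_ord.
Qed.

(** Multiplication by X - 1 takes differences of consecutive values, which vanish in the end; at 1
    they telescope to -c. *)
Lemma rep_fun_ev_cst_poly (m : nat) (b e : 'I_m.+1 -> nat) (A : set nat)
    (c n0 : nat) :
  (forall i, 0 < b i)%N ->
  (forall n, (n0 < n)%N -> rep_fun b e A n = c) ->
  exists2 Q : {poly int}, Q.[1] = - c%:R &
    fps_of_poly ('X - 1) * (\prod_(ij : {i : 'I_m.+1 & 'I_(e i)})
      fps_comp_Xn (b (tag ij)) (fps_set A)) =
    fps_of_poly (map_poly intr Q).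
Proof.
(* [r] is shifted by one place, with value 0 at 0, so that r_i - r_(i+1) is the coefficient of index
   i for i = 0 too. The last index n0 + 1 leaves the value at n0 + 1, which is [c]. *)
move=> b_gt0 r_cst; pose r n : int := if n is k.+1 then (rep_fun b e A k)%:R else 0.
exists (\poly_(i < n0.+2) (r i - r i.+1)).
  rewrite horner_poly; under eq_bigr do rewrite expr1n mulr1 -opprB.
  rewrite sumrN -(big_mkord xpredT (fun i => r i.+1 - r i)) telescope_sumr //.
  by rewrite subr0 /= r_cst.
apply/funext => n; rewrite -['X]expr1 rmorphB rmorph1 mulrBl mul1r fpsB fps_polyXnM.
rewrite -!rep_fun_coef // /fps_of_poly coef_map coef_poly.
case: n => [|n]; first by rewrite [RHS]rmorphB rmorph0 rmorph_nat.
rewrite subn1 [(n.+1 < 1)%N]ltnS ltn0;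
case: ifPn => n_ge; first by rewrite [RHS]rmorphB !rmorph_nat.
by rewrite !r_cst ?subrr ?rmorph0 //; lia.
Qed.

Local Close Scope ring_scope.

Theorem theorem1p2 (m : nat) (b e : 'I_m.+1 -> nat)
    (m_ge1 : 1 <= m)
    (b0_gt0 : 0 < b ord0)
    (b_incr : forall i j : 'I_m.+1, i < j -> b i < b j)
    (e_gt0 : forall i : 'I_m.+1, 0 < e i)
    (p_adic : exists p t : nat,
       [/\ prime p, 0 < t, p ^ t %| b ord0
         & forall i : 'I_m.+1, 1 <= i -> ~~ (p ^ t %| b i)])
    (A : set nat)
    (A_gt0 : forall a, A a -> 0 < a)
    (A_infinite : infinite_set A) :
  ~ exists c n0 : nat, forall n : nat, n0 < n -> rep_fun b e A n = c.
Proof.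
move=> [c [n0 r_cst]].
have [p [v [p_prime _ pb0 pbi]]] := p_adic.
have ord_gt0 i : i != ord0 -> (ord0 : 'I_m.+1) < i.
  by rewrite -val_eqE lt0n.
have b_gt i : i != ord0 -> b ord0 < b i by move=> /ord_gt0/b_incr.
have b_gt0 i : 0 < b i.
  by have [->|/b_gt] := eqVneq i ord0; last exact: leq_ltn_trans.
have b_logn i : i != ord0 -> logn p (b i) < logn p (b ord0).
  move=> /ord_gt0/pbi; rewrite pfactor_dvdn // -ltnNge => /leq_trans; apply.
  by rewrite -pfactor_dvdn.
have [x Ax x_gt] : exists2 x, A x & n0 < x.
  apply: contrapT => none; apply: A_infinite.
  apply: (sub_finite_set _ (finite_II n0.+1)) => x Ax /=.
  by rewrite ltnS leqNgt; apply/negP => x_gt; apply: none; exists x.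
(* The tuple with all entries [x] represents a number that is at least x > n0. *)
have c_neq0 : c != 0.
  rewrite -lt0n -(r_cst (\sum_i b i * (e i * x))) ?rep_fun_gt0 //.
  rewrite (bigD1 ord0) //= (leq_trans x_gt) // (leq_trans _ (leq_addr _ _)) //.
  by rewrite mulnA leq_pmull // muln_gt0 b_gt0 e_gt0.
have [Q Q1 QE] := rep_fun_ev_cst_poly b_gt0 r_cst.
have Q1_neq0 : Q.[1]%R != 0%R by rewrite Q1 oppr_eq0 pnatr_eq0.
have Q_neq0 : Q != 0%R by apply: contraNneq Q1_neq0 => ->; rewrite horner0.
have [s [t [Q2 [s_gt0 t_gt0 st [Q2_neq0 Q2_nt] /(_ Q1_neq0) size_st]]]] :=
  cyclotomic_part Q_neq0.
have [rs Q2E] := closed_field_poly_normal (map_poly (intr : int -> algC) Q2).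
have lead_neq0 : lead_coef (map_poly (intr : int -> algC) Q2) != 0%R.
  by rewrite lead_coef_eq0 map_poly_eq0_id0 ?intr_eq0 ?lead_coef_eq0.
have rs_nt a : a \in rs -> ~ torsion a.
  by move=> a_rs; apply: Q2_nt; rewrite Q2E rootZ // root_prod_XsubC.
have f_neq0 : fps_set A != 0%R.
  apply/eqP => /(congr1 (fun f : fps algC => f x)) /eqP.
  by rewrite /fps_set (asboolT Ax) oner_eq0.
have [l lE] := log_deriv_exists f_neq0.
(* The factor X - 1 joins those of [s], making this list one longer than [t]. *)
have [ls lsE ls_n] := log_deriv_prod_Xn_sub1 (1 :: s).
have [lt ltE lt_n] := log_deriv_prod_Xn_sub1 t.
have [l2 l2E l2_n] := log_deriv_poly (lead_coef (map_poly (intr : int -> algC) Q2)) rs.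
rewrite -Q2E in l2E.
have [L HE L_n] := log_deriv_prod_comp_Xn e b_gt0 lE.
have LE := log_derivM HE lsE; have RE := log_derivM ltE l2E.
(* [QE] times the factors of [s], rewritten by [st]: one series in two factorizations, whose
   logarithmic derivatives must agree. *)
have W : (fps_of_poly (map_poly intr (prod_Xn_sub1 t)) *
    fps_of_poly (map_poly intr Q2) =
   (\prod_(ij : {i : 'I_m.+1 & 'I_(e i)}) fps_comp_Xn (b (tag ij)) (fps_set A)) *
    fps_of_poly (map_poly intr (prod_Xn_sub1 (1%N :: s))) :> fps algC)%R.
  rewrite -rmorphM -rmorphM -st /prod_Xn_sub1 big_cons !rmorphM /= -QE.
  rewrite [in RHS]rmorphB /= map_polyXn rmorph1 expr1.
  by rewrite mulrA [X in (X * _)%R]mulrC.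
rewrite -W in LE.
have W_neq0 : (fps_of_poly (map_poly (intr : int -> algC) (prod_Xn_sub1 t)) *
    fps_of_poly (map_poly intr Q2) != 0 :> fps algC)%R.
  rewrite -rmorphM -rmorphM -(rmorph0 (@fps_of_poly algC)).
  rewrite (inj_eq (@fps_of_poly_inj _)) map_poly_eq0_id0 ?intr_eq0 ?lead_coef_eq0.
    by rewrite mulf_neq0 ?prod_Xn_sub1_neq0.
  by rewrite mulf_neq0 ?prod_Xn_sub1_neq0.
have LR := log_deriv_uniq W_neq0 LE RE.
apply: (@log_eq_no_solution m b e p (1 :: s) t rs l) => //=;
  first by rewrite size_st.
move=> n n_gt0; have := congr1 (fun f : fps algC => f n) LR.
rewrite !fpsD L_n ls_n // lt_n // l2_n //.
move=> /(canRL (addrK _)) ->; rewrite opprK addrAC; congr (_ + _)%R.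
by rewrite addrC.
Qed.
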